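(* Let $M\subseteq\mathbb{T}$ satisfy the standing hypothesis. The complete shell $\mathrm{shell}_{\oplus}(\rho^\forall_M)$ of the universal closure for $\oplus$ exists, and its set of fixpoints is the closure under arbitrary unions of the family $\{\ominus^n(X)\mid n\in\mathbb{N},\ X\text{ a fixpoint of }\rho^\forall_M\}$.
   Context: $\mathbb{T}$ is the set of traces $\langle i,\sigma\rangle$, $i\in\mathbb{Z}$, $\sigma:\mathbb{Z}\to\mathbb{S}$; $X_{\downarrow s}=\{\langle i,\sigma\rangle\in X\mid\sigma_i=s\}$; $\oplus(X)=\{\langle i,\sigma\rangle\mid\langle i+1,\sigma\rangle\in X\}$, $\ominus(X)=\{\langle i,\sigma\rangle\mid\langle i-1,\sigma\rangle\in X\}$, $\curvearrowleft(X)=\{\langle -i,\lambda k.\sigma_{-k}\rangle\mid\langle i,\sigma\rangle\in X\}$. Standing hypothesis on $M$: (i) $|M_{\downarrow s}|>1$ for all $s$; (ii) $\oplus(M)=M=\ominus(M)$ and $\oplus(\curvearrowleft M)=\curvearrowleft M=\ominus(\curvearrowleft M)$. $\rho^\forall_M(X)=\{\langle i,\sigma\rangle\in M\mid M_{\downarrow\sigma_i}\subseteq X\}$. Upper closure operators on $\langle\wp(\mathbb{T}),\supseteq\rangle$: maps monotone w.r.t. $\subseteq$, idempotent, with $\rho(X)\subseteq X$; ordered by $\rho\sqsubseteq\eta$ iff $\rho(X)\supseteq\eta(X)$ for all $X$; identified with their sets of fixpoints. $\rho$ is complete for $f$ if $\rho\circ f=\rho\circ f\circ\rho$. The complete shell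 of $\rho$ for $f$ is the $\sqsubseteq$-greatest closure $\eta$ with $\eta\sqsubseteq\rho$ that is complete for $f$. *)

(* Defs.v *)
From mathcomp Require Import all_boot all_order all_algebra.
From mathcomp Require Import boolp classical_sets functions cardinality.

Set Implicit Arguments.
Unset Strict Implicit.
Unset Printing Implicit Defensive.

Local Open Scope ring_scope.
Local Open Scope classical_set_scope.
Local Open Scope card_scope.

(* The pair [(i, s)] is the trace <i, s>: the path [s] observed at time [i]. *)
Definition trace (S : Type) : Type := (int * (int -> S))%type.

Section Traces.
Variable S : Type.
Implicit Types (X Y M : set (trace S)).

Definition current (t : trace S) : S := t.2 t.1.

Definition restr X (s : S) : set (trace S) := [set t | X t /\ current t = s].

Definition oplus X : set (trace S) := [set t : trace S | X (t.1 + 1, t.2)].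

Definition ominus X : set (trace S) := [set t : trace S | X (t.1 - 1, t.2)].

Definition reversal X : set (trace S) :=
  [set (- t.1, fun k => t.2 (- k)) | t in X].

Definition standing_hypothesis M : Prop :=
  [/\ forall s, ~~ (restr M s #<= `I_1),
      oplus M = M, ominus M = M,
      oplus (reversal M) = reversal M & ominus (reversal M) = reversal M].

Definition rho_forall M X : set (trace S) :=
  [set t | M t /\ restr M (current t) `<=` X].

End Traces.

Section Closures.
Variable T : Type.
Implicit Types (rho eta f : set T -> set T).

(* Upper closure operators on the powerset ordered by reverse inclusion, hence
   reductive with respect to inclusion. *)
Definition is_uco rho : Prop :=
  [/\ forall X Y, X `<=` Y -> rho X `<=` rho Y,
      forall X, rho (rho X) = rho X &
      forall X, rho X `<=` X].

Definition uco_le rho eta : Prop := forall X, eta X `<=` rho X.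

Definition fixpoints rho : set (set T) := [set X | rho X = X].

Definition complete_for f rho : Prop := rho \o f = rho \o f \o rho.

Definition is_complete_shell f rho eta : Prop :=
  [/\ is_uco eta, uco_le eta rho, complete_for f eta &
      forall mu, is_uco mu -> uco_le mu rho -> complete_for f mu ->
        uco_le mu eta].

Definition union_closure (F : set (set T)) : set (set T) :=
  [set Y | exists2 G : set (set T), G `<=` F & Y = \bigcup_(X in G) X].

Lemma is_complete_shell_unique f rho eta1 eta2 :
  is_complete_shell f rho eta1 -> is_complete_shell f rho eta2 -> eta1 = eta2.
Proof.
move=> [u1 l1 c1 g1] [u2 l2 c2 g2]; apply/funext => X; apply/seteqP; split.
- exact: g1 u2 l2 c2 X.
- exact: g2 u1 l1 c1 X.
Qed.

End Closures.

Lemma is_uco_rho_forall (S : Type) (M : set (trace S)) : is_uco (rho_forall M).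
Proof.
have red X : rho_forall M X `<=` X by move=> t [Mt]; apply.
split=> // [X Y XY t [Mt h]|X]; first by split => // u /h /XY.
apply/seteqP; split; first exact: red.
move=> t [Mt h]; split=> // u [Mu eu]; split=> //.
by rewrite eu.
Qed.

(* Main.v *)
Require Import Defs.
From mathcomp Require Import all_boot all_order all_algebra.
From mathcomp Require Import boolp classical_sets functions cardinality.

(** If [f] has a lower adjoint [g] for inclusion, a closure is complete for [f]
    exactly when its fixpoints are stable under [g]. Hence the complete shell of
    a closure is generated, under unions, by the iterates of [g] on its
    fixpoints. The theorem is the case [f = oplus], [g = ominus]. *)

Set Implicit Arguments.
Unset Strict Implicit.
Unset Printing Implicit Defensive.

Local Open Scope classical_set_scope.

Section InteriorOperator.
Variables (T : Type) (F : set (set T)).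
Implicit Types X Y Z : set T.

(** [F] acts as a base of open sets: the value is a union of members of [F], not always a member
    itself. *)
Definition family_interior X : set T :=
  \bigcup_(Z in [set Z | F Z /\ Z `<=` X]) Z.

Lemma family_interior_max X Z : F Z -> Z `<=` X -> Z `<=` family_interior X.
Proof. by move=> FZ ZX t Zt; exists Z. Qed.

Lemma is_uco_family_interior : is_uco family_interior.
Proof.
have red X : family_interior X `<=` X by move=> t [Z [_ ZX] /ZX].
split=> // [X Y XY t [Z [FZ ZX] Zt]|X].
  by exists Z => //; split=> // u /ZX /XY.
apply/seteqP; split; first exact: red.
by move=> t [Z [FZ ZX] Zt]; exists Z => //; split=> //; exact: family_interior_max.
Qed.

Lemma fixpoints_family_interior : fixpoints family_interior = union_closure F.
Proof.
apply/seteqP; split=> [X eX|_ [G GF ->]].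
  by exists [set Z | F Z /\ Z `<=` X]; [move=> Z [] | rewrite -{1}eX].
apply/seteqP; split; first by case: is_uco_family_interior => _ _; apply.
move=> t [Z GZ Zt]; exists Z => //; split; first exact: GF.
by move=> u Zu; exists Z.
Qed.

End InteriorOperator.

Section CompleteShellOfAdjoint.
Variables (T : Type) (f g : set T -> set T).
Hypothesis adj : forall X Y, g X `<=` Y <-> X `<=` f Y.

(** The unit [Y] ⊆ [f (g Y)] and completeness at [g Y] give [Y = mu Y] ⊆ [mu (f (mu (g Y)))] ⊆
    [f (mu (g Y))]; transposing yields [g Y] ⊆ [mu (g Y)]. *)
Lemma complete_for_fixpoints_stable mu Y :
  is_uco mu -> complete_for f mu -> fixpoints mu Y -> fixpoints mu (g Y).
Proof.
move=> [mono _ red] comp eY; apply/seteqP; split; first exact: red.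
apply/adj; rewrite -[X in X `<=` _]eY.
have sub : mu Y `<=` mu (f (g Y)) by apply: mono; apply/adj.
apply: (subset_trans sub).
by rewrite [mu (f _)](congr1 (@^~ (g Y)) comp); exact: red.
Qed.

(** A member [Z] of [F] inside [f X] transposes to the member [g Z] inside [X], hence inside its
    interior; transposing back puts [Z] inside [f] of that interior. *)
Lemma complete_for_family_interior (F : set (set T)) :
  (forall Z, F Z -> F (g Z)) -> complete_for f (family_interior F).
Proof.
move=> gF; have [mono _ red] := is_uco_family_interior F.
(* Transpose the counit [g (f X)] ⊆ [X] ⊆ [Y]. *)
have monof X Y : X `<=` Y -> f X `<=` f Y.
  by move=> XY; apply/adj/(subset_trans _ XY)/adj.
apply/funext => X; apply/seteqP; split=> /=; last by apply/mono/monof; exact: red.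
move=> t [Z [FZ ZfX] Zt]; exists Z => //; split=> //.
by apply/adj; apply: family_interior_max; [exact: gF | apply/adj].
Qed.

Theorem complete_shell_of_adjoint rho : is_uco rho ->
  is_complete_shell f rho
    (family_interior
      [set Y | exists (n : nat) X, fixpoints rho X /\ Y = iter n g X]).
Proof.
move=> [_ idem red]; set F := [set Y | _]; split.
- exact: is_uco_family_interior.
- move=> X; apply: family_interior_max (red X).
  (* The zeroth iterates place [rho X] itself in the family. *)
  by exists 0, (rho X); split=> //; exact: idem.
- apply: complete_for_family_interior => _ [n [X [fX ->]]].
  by exists n.+1, X.
- move=> mu umu lemu cmu X t [_ [[n [Y [fY ->]]] YX] Yt].
  have [mono _ redmu] := umu.
  (* A competitor fixes every generator: [Y = rho Y] ⊆ [mu Y] starts the induction, and stability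
     under [g] carries it on. *)
  have fmu : fixpoints mu (iter n g Y).
    elim: n {YX Yt} => [|n IHn] /=; last exact: complete_for_fixpoints_stable.
    by apply/seteqP; split; [exact: redmu | rewrite -{1}fY; exact: lemu].
  by apply: mono YX _ _; rewrite fmu.
Qed.

End CompleteShellOfAdjoint.

(** Both come from the bijection sending time [i] to [i + 1]: [ominus] is its direct image, [oplus]
    its preimage. *)
Lemma ominus_oplus_adjoint (S : Type) (X Y : set (trace S)) :
  ominus X `<=` Y <-> X `<=` oplus Y.
Proof.
split=> [XY [i s] Xt|XY [i s] /XY]; last by rewrite /oplus /= GRing.subrK.
by apply: XY; rewrite /ominus /= GRing.addrK.
Qed.

Theorem theorem9 (S : Type) (M : set (trace S)) (hM : standing_hypothesis M) :
  exists eta : set (trace S) -> set (trace S),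
    is_complete_shell (@oplus S) (rho_forall M) eta /\
    fixpoints eta =
      union_closure
        [set Y | exists (n : nat) (X : set (trace S)),
                   fixpoints (rho_forall M) X /\ Y = iter n (@ominus S) X].
Proof.
(* Unification with the fixpoint equation chooses [eta] as the interior operator of the family. *)
eexists; split; last exact: fixpoints_family_interior.
apply: complete_shell_of_adjoint; last exact: is_uco_rho_forall.
exact: ominus_oplus_adjoint.
Qed.
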